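(* Assume that $X[\mathcal{T}]$ is a locally convex topological vector space, $\mathcal{C}$ is a non-decreasing countable localizing family in $X$, each member of $\mathcal{C}$ is $\mathcal{T}$-compact, and for each $C\in\mathcal{C}$ the topology $\mathcal{T}|_C$ is sequential. The following hold. (A) $X[\mathcal{T}_{\mathcal{C}}]$ is sequential. (B) If $Y\subseteq X$ is a $\mathcal{T}_{\mathcal{C}}$-closed vector subspace (in particular, if $Y$ is $\mathcal{T}$-closed) then $\mathcal{T}_{\mathcal{C}}|_Y=(\mathcal{T}|_Y)_{\mathcal{C}|_Y}$.
   Context: All vector spaces are real; topological vector spaces are Hausdorff. $X[\mathcal{T}]$ denotes $X$ equipped with the topology $\mathcal{T}$; for a collection $\mathcal{T}$ of subsets of $X$ and $C\subseteq X$, $\mathcal{T}|_C=\{E\cap C:E\in\mathcal{T}\}$ (so $\mathcal{C}|_Y=\{C\cap Y:C\in\mathcal{C}\}$, which is a localizing family in $Y$). A localizing family in a vector space $X$ is a non-empty collection $\mathcal{C}$ of convex subsets of $X$ containing $0$ such that for all $C\in\mathcal{C}$, $x\in X$, $t\in\mathbb{R}$ there is $D\in\mathcal{C}$ with $x+t\cdot C\subseteq D$. It is non-decreasing countable if it can be numbered $\mathcal{C}=\{C_k:k\in\mathbb{N}\}$ with $C_k\subseteq C_{k+1}$ for all $k$. Given a locally convex topology $\mathcal{T}$ on $X$ and a localizing family $\mathcal{C}$, the localization $\mathcal{T}_{\mathcal{C}}$ is the locally convex vector topology on $X$ consisting of all $E\subseteq X$ such that for every $x\in E$ there is a convex $V$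 with $x\in V\subseteq E$ and $V\cap C\in\mathcal{T}|_C$ for every $C\in\mathcal{C}$. A Hausdorff topological space is sequential if every sequentially closed set (one containing the limits of all its convergent sequences) is closed. *)

(* Defs.v *)
From HB Require Import structures.
From mathcomp Require Import all_boot all_order all_algebra.
From mathcomp Require Import all_classical all_reals all_analysis.

Set Implicit Arguments.
Unset Strict Implicit.
Unset Printing Implicit Defensive.

Import Order.TTheory GRing.Theory Num.Theory.

Local Open Scope classical_set_scope.
Local Open Scope ring_scope.

Definition seq_closed (T : topologicalType) (A : set T) : Prop :=
  forall (u : nat -> T) (x : T),
    (forall n, A (u n)) -> u @ \oo --> x -> A x.

Definition sequential_space (T : topologicalType) : Prop :=
  hausdorff_space T /\ forall A : set T, seq_closed A -> closed A.

Definition localizing_family (R : numDomainType) (X : lmodType R)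
    (C : set (set X)) : Prop :=
  [/\ C !=set0,
      forall A, C A -> convex_set A /\ A 0
    & forall A (x : X) (t : R), C A ->
        exists2 D, C D & [set x + t *: a | a in A] `<=` D].

Definition nondecreasing_countable (X : Type) (C : set (set X)) : Prop :=
  exists2 A : nat -> set X, C = range A & forall k, A k `<=` A k.+1.

(* The family of all E with the defining property of the localization is a
   topology for every family C, localizing or not, so that the type
   [localized C] is available without hypotheses on C. *)
Definition localized_open (R : numDomainType) (X : preTopologicalLmodType R)
    (C : set (set X)) : set (set X) :=
  [set E | forall x, E x -> exists V : set X,
     [/\ convex_set V, V x, V `<=` E
       & forall A, C A -> [set U `&` A | U in open] (V `&` A)]].

(* A copy of X carrying the localized topology; cf [localized_openE]. *)
Definition localized (R : numDomainType) (X : preTopologicalLmodType R)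
  (C : set (set X)) : Type := X.

Section localized_topology.
Context (R : numDomainType) (X : preTopologicalLmodType R) (C : set (set X)).

Let localized_openT : localized_open C setT.
Proof.
move=> x _; exists setT; split => // A _; exists setT => //; exact: openT.
Qed.

Let localized_openI : setI_closed (localized_open C).
Proof.
move=> E F oE oF x [/oE[V [cV Vx VE oV]] /oF[W [cW Wx WF oW]]].
exists (V `&` W); split => //.
- move=> y z l; rewrite !in_setI => /andP[Vy Wy] /andP[Vz Wz].
  by rewrite cV// cW.
- exact: setISS.
- move=> A CA; have [U oU UA] := oV A CA; have [U' oU' UA'] := oW A CA.
  exists (U `&` U'); first exact: openI.
  by rewrite setIIl UA UA' -setIIl.
Qed.

Let localized_open_bigU (I : Type) (f : I -> set X) :
  (forall i, localized_open C (f i)) -> localized_open C (\bigcup_i f i).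
Proof.
move=> of_ x [i _ /of_[V [cV Vx Vf oV]]]; exists V; split => //.
by move=> y /Vf fy; exists i.
Qed.

HB.instance Definition _ := GRing.Lmodule.copy (localized C) X.
HB.instance Definition _ := isOpenTopological.Build (localized C)
  localized_openT localized_openI localized_open_bigU.

Lemma localized_openE : @open (localized C) = localized_open C.
Proof. by []. Qed.

End localized_topology.

(* The vector subspace Y as a topological vector space of its own, with the
   vector space structure and the topology inherited from X. *)
Definition submod_type (R : numDomainType) (X : preTopologicalLmodType R)
  (Y : submodClosed X) : Type := {x : X | x \in Y}.

Section submod_type.
Context (R : numDomainType) (X : preTopologicalLmodType R)
  (Y : submodClosed X).

HB.instance Definition _ := SubChoice.copy (submod_type Y) {x : X | x \in Y}.
HB.instance Definition _ :=
  [SubChoice_isSubLmodule of submod_type Y by <:].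
HB.instance Definition _ := Topological.copy (submod_type Y)
  (initial_topology (val : submod_type Y -> X)).

Lemma submod_openE :
  @open (submod_type Y) = [set (val : submod_type Y -> X) @^-1` E | E in open].
Proof. by []. Qed.

(* The trace on Y of a collection of subsets of X, as a collection of subsets
   of the type of the elements of Y. *)
Definition trace (F : set (set X)) : set (set (submod_type Y)) :=
  [set (val : submod_type Y -> X) @^-1` E | E in F].

End submod_type.

Arguments trace {R X} Y F.

(* Main.v *)
(* The key point is that a set [E] which is relatively open in every member of
   [C] is already open for the localized topology.  Given [x] in [E], put
   [K_0 = {x}] and [K_(n+1) = (K_n + U_n) `&` C_(n+1)], where the convex
   neighbourhood [U_n] of 0 is so small that the closure of [K_(n+1)] stays in
   [E]; it exists because the closure of [K_n], which lies in [C_n], is compact.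
   The increasing union of the [K_n] is the required convex set.  Both claims
   then reduce to relative openness in each [C_n]: for (B), an open set [F] of
   [Y] extends to the open set [F `|` ~` Y] of [X]. *)
Require Import Defs.
From HB Require Import structures.
From mathcomp Require Import all_boot all_order all_algebra.
From mathcomp Require Import all_classical all_reals all_analysis.

Import Order.TTheory GRing.Theory Num.Theory.

Local Open Scope classical_set_scope.
Local Open Scope ring_scope.

(** Turns relative openness into a pointwise condition, the form in which filters and compactness
    apply; the open witness is the interior of [A -> E]. *)
Lemma relative_openP (T : topologicalType) (E A : set T) :
  [set U `&` A | U in open] (E `&` A) <->
  (forall x, A x -> E x -> \forall y \near x, A y -> E y).
Proof.
split=> [[U oU UA] x Ax Ex|nE].
  have [Ux _] : (U `&` A) x by rewrite UA.
  near=> y => Ay; have [] // : (E `&` A) y.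
  by rewrite -UA; split => //; near: y; exact: open_nbhs_nbhs.
exists (interior [set y | A y -> E y]); first exact: open_interior.
apply/seteqP; split=> y [] Uy Ay; split => //.
- exact: (interior_subset Uy).
- exact: nE.
Unshelve. all: by end_near. Qed.

Lemma conv_lmodE (R : numDomainType) (M : lmodType R)
    (x y : convex_lmodType M) (l : {i01 R}) :
  conv l x y = (l%:num *: (x : M) + (1 - l%:num) *: (y : M))%R.
Proof. by []. Qed.

Lemma convex_setP (R : numDomainType) (M : lmodType R) (A : set M) :
  convex_set A <-> (forall x y (l : {i01 R}), A x -> A y ->
    A (l%:num *: x + (1 - l%:num) *: y)%R).
Proof.
by split=> cA x y l; have := cA x y l; rewrite !inE.
Qed.

Lemma convex_nbhs (R : numDomainType) (X : tvsType R) (x : X) (N : set X) :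
  nbhs x N -> exists U, [/\ convex_set U, open U, U x & U `<=` N].
Proof.
move=> xN; have [B cB [oB Bx]] := @locally_convex R X.
have [U [BU Ux] UN] := Bx x N xN.
by exists U; split => //; [apply: cB; rewrite inE|exact: oB].
Qed.

(** One step of the construction, with [K' = (K + U) & B]. Compactness of [closure K] makes a single
    convex [U] small enough for all its points at once. *)
Lemma convex_enlarge (R : numDomainType) (X : tvsType R) (K B E : set X) :
  hausdorff_space X -> convex_set K -> convex_set B -> compact B ->
  K `<=` B -> closure K `<=` E ->
  (forall x, B x -> E x -> \forall y \near x, B y -> E y) ->
  exists K', [/\ convex_set K', K `<=` K', K' `<=` B, closure K' `<=` E
    & forall x, K x -> \forall y \near x, B y -> K' y].
Proof.
move=> hX cK cB kB KB KE nE.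
have closure_sub A : A `<=` B -> closure A `<=` B.
  by move=> /closureS /subset_trans; apply; exact: compact_closed.
have kK : compact (closure K).
  apply: (subclosed_compact _ kB); [exact: closed_closure|exact: closure_sub].
pose N := [set w | closure K `<=` [set z | B (z + w) -> E (z + w)]].
have N0 : nbhs (0 : X) N.
  (* Tube argument: it suffices to treat pairs near [(z, 0)] for each [z] in [closure K], where
     continuity of addition applies. *)
  apply: (compact_near_coveringP _).1 kK _ _ _ _ _ => z Kz.
  have : nbhs (z + 0) [set y | B y -> E y].
    by rewrite addr0; apply: nE; [exact: (closure_sub _ KB)|exact: KE].
  exact: (@add_continuous X (z, 0)).
(* Differences of elements of [U] must lie in [N], since a point of [closure K'] is only known up to
   a further error in [U]. *)
have [[N1 N2] /= [N10 N20] N12] : nbhs (0 : X, 0 : X) [set u | N (u.1 - u.2)].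
  by apply: (@sub_continuous X (0, 0)); rewrite /= subr0.
have [U [cU oU U0 UN]] := convex_nbhs _ _ _ _ (filterI N10 N20).
have nU (y : X) : \forall z \near y, exists2 u, U u & y + u = z.
  by apply: nbhsT; exact: open_nbhs_nbhs.
exists ([set k + u | k in K & u in U] `&` B); split.
- apply/convex_setP => _ _ l [[k Kk [u Uu <-]] ?] [[k' Kk' [u' Uu' <-]] ?].
  split; last by move/convex_setP: cB; exact.
  exists (l%:num *: k + (1 - l%:num) *: k').
    by move/convex_setP: cK; exact.
  exists (l%:num *: u + (1 - l%:num) *: u').
    by move/convex_setP: cU; exact.
  by rewrite !scalerDr addrACA.
- move=> k Kk; split; last exact: KB.
  by exists k => //; exists 0 => //; rewrite addr0.
- by move=> ? [].
- move=> y Ky; have By : B y by apply: (closure_sub _ _ _ Ky) => ? [].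
  (* The neighbourhood [y + U] meets [K'], so [y + u = k + u'] with [k] in [K]. *)
  have [_ [[[k Kk [u' Uu' <-]] _] [u Uu uE]]] := Ky _ (nU y).
  have -> : y = k + (u' - u) by rewrite addrA -uE addrK.
  have Nu : N (u' - u).
    by apply: (N12 (u', u)); split; [case: (UN u')|case: (UN u)].
  apply: Nu; first exact: subset_closure.
  by rewrite addrA -uE addrK.
- move=> k Kk; apply: filterS (nU k) => z [u Uu <-] Bz; split => //.
  by exists k => //; exists u.
Qed.

Section localization.
Context (R : numDomainType) (X : tvsType R) (C : set (set X)).

Lemma localized_open_near (E : set X) : localized_open C E ->
  forall A, C A -> forall x, A x -> E x -> \forall y \near x, A y -> E y.
Proof.
move=> oE A CA x Ax /oE[V [_ Vx VE /(_ A CA) /relative_openP oV]].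
by apply: filterS (oV x Ax Vx) => y + Ay => /(_ Ay) /VE.
Qed.

Lemma localized_open_finer (E : set X) : open E -> localized_open C E.
Proof.
move=> oE x Ex.
have [V [cV oV Vx VE]] := convex_nbhs _ _ _ _ (open_nbhs_nbhs (conj oE Ex)).
by exists V; split => // A CA; exists V.
Qed.

Lemma localized_hausdorff :
  hausdorff_space X -> hausdorff_space (localized C).
Proof.
move=> hX p q pq; apply: hX => A B; rewrite !nbhsE.
move=> [U [oU Up] UA] [V [oV Vq] VB].
have loc_nbhs (W : set X) (x : localized C) :
    open W -> W x -> nbhs x (W : set (localized C)).
  move=> oW Wx; apply: open_nbhs_nbhs; split => //.
  exact: localized_open_finer.
have [z [Uz Vz]] := pq _ _ (loc_nbhs _ _ oU Up) (loc_nbhs _ _ oV Vq).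
by exists z; split; [exact: UA|exact: VB].
Qed.

Lemma localizing_family_cover (x : X) :
  localizing_family C -> exists2 A, C A & A x.
Proof.
move=> [[A CA] C0 Ct]; have [D CD AD] := Ct A x 0 CA.
exists D => //; apply: AD; exists 0; first exact: (C0 A CA).2.
by rewrite scaler0 addr0.
Qed.

Hypotheses (hX : hausdorff_space X) (locC : localizing_family C).
Hypotheses (ndC : nondecreasing_countable C).
Hypothesis compactC : forall A, C A -> compact A.

(** Removes convexity from the test for openness: the convex set that the definition demands is
    built by iterating [convex_enlarge]. *)
Lemma near_localized_open (E : set X) :
  (forall A, C A -> forall x, A x -> E x -> \forall y \near x, A y -> E y) ->
  localized_open C E.
Proof.
move=> nE x Ex.
have [_ C0 _] := locC.
have [A CE And] := ndC.
have CA n : C (A n) by rewrite CE; exists n.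
have Ale : {homo A : m n / (m <= n)%N >-> m `<=` n}.
  by apply: homo_leq And => [B|D B F]; [exact: subset_refl|exact: subset_trans].
have CP D : C D -> exists k, D = A k by rewrite CE => -[k _ <-]; exists k.
(* The numbering is shifted by [k0] so that the first stage, the singleton of [x], already lies in
   its member of [C]. *)
have [_ /CP[k0 ->] Ax] := localizing_family_cover x locC.
pose P n K := [/\ convex_set K, K `<=` A (k0 + n)%N & closure K `<=` E].
pose Q n (K K' : set X) := [/\ P n.+1 K', K `<=` K'
  & forall y, K y -> \forall z \near y, A (k0 + n.+1)%N z -> K' z].
(* [choice] needs a total function; where [P] fails nothing is claimed and [K] itself is the default
   value. *)
have /choice[f fP] (nK : nat * set X) :
    exists K', P nK.1 nK.2 -> Q nK.1 nK.2 K'.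
  case: nK => n K /=; have [[cK KA KE]|nP] := pselect (P n K); last by exists K.
  have [K' [? ? ? ? ?]] : exists K', [/\ convex_set K', K `<=` K',
      K' `<=` A (k0 + n.+1)%N, closure K' `<=` E
      & forall x, K x -> \forall y \near x, A (k0 + n.+1)%N y -> K' y].
    apply: convex_enlarge => //.
    - exact: (C0 _ (CA _)).1.
    - exact: compactC.
    - by apply: subset_trans KA _; apply: Ale; rewrite leq_add2l.
    - exact: nE.
  by exists K'.
pose F := nat_rect (fun=> set X) [set x] (fun n K => f (n, K)).
have PF n : P n (F n).
  elim: n => [|n IH]; last by have [] := fP (n, F n) IH.
  split=> [y z l /[!inE] /= -> ->|_ ->|].
  - by rewrite conv_lmodE -scalerDl addrC subrK scale1r.
  - by rewrite addn0.
  - have /closure_id <- : closed [set x]; last by move=> _ ->.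
    by apply: compact_closed => //; exact: compact_set1.
have QF n : Q n (F n) (F n.+1) by exact: (fP (n, F n) (PF n)).
have Fle : {homo F : m n / (m <= n)%N >-> m `<=` n}.
  apply: homo_leq => [B|D B G|n]; [exact: subset_refl|exact: subset_trans|].
  by have [] := QF n.
exists (\bigcup_n F n); split.
- apply/convex_setP => y z l [m _ Fy] [n _ Fz]; exists (maxn m n) => //.
  have [/convex_setP cF _ _] := PF (maxn m n).
  by apply: cF; [apply: Fle Fy|apply: Fle Fz]; rewrite ?leq_maxl ?leq_maxr.
- by exists 0%N.
- by move=> y [n _ Fy]; have [_ _] := PF n; apply; exact: subset_closure.
- move=> _ /CP[k ->]; apply/relative_openP => y _ [n _ Fy].
  have [_ _ nF] := QF (n + k)%N.
  apply: filterS (nF y (Fle _ _ (leq_addr k n) _ Fy)) => z + Az.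
  move=> Fz; exists (n + k).+1 => //; apply: Fz; apply: Ale Az.
  by rewrite addnS addnA leqW // leq_addl.
Qed.

Lemma localized_sequential :
  (forall A, C A -> sequential_space (set_type A)) ->
  sequential_space (localized C).
Proof.
move=> seqC; split=> [|B sB]; first exact: localized_hausdorff.
rewrite -[B]setCK; apply: open_closedC.
apply: near_localized_open => A CA; apply/relative_openP.
have /closed_openC[U oU UE] : closed ((set_val : set_type A -> X) @^-1` B).
  (* A sequence converging in [A] also converges in the localized topology, because on [A] each
     localized open [G] coincides with an open [V] of [X]. *)
  apply: (seqC A CA).2 => u a uB ua; apply: (sB (fun n => set_val (u n)) _ uB).
  move=> W; rewrite nbhsE => -[G [oG Ga] GW].
  have /relative_openP[V oV VA] := localized_open_near G oG A CA.
  have /ua uV : nbhs a (set_val @^-1` V).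
    apply: initial_continuous; apply: open_nbhs_nbhs; split => //.
    suff [] : (V `&` A) (set_val a) by [].
    by rewrite VA; split => //; exact: set_valP.
  suff : \forall n \near \oo, W (set_val (u n)) by [].
  have : \forall n \near \oo, V (set_val (u n)) by exact: uV.
  apply: filterS => n Vn; apply: GW.
  suff [] : (G `&` A) (set_val (u n)) by [].
  by rewrite -VA; split => //; exact: set_valP.
exists U => //; apply/seteqP; split=> y [Hy Ay]; split=> //.
- have : (set_val @^-1` U) (SigSub (mem_set Ay)) by [].
  by rewrite UE.
- have : (~` (set_val @^-1` B)) (SigSub (mem_set Ay)) by [].
  by rewrite -UE.
Qed.

Lemma trace_localized_open (Y : submodClosed X) :
  @closed (localized C) [set` Y] ->
  trace Y (localized_open C) = localized_open (trace Y C).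
Proof.
move=> /closed_openC oY; apply/seteqP; split=> [_ [E oE <-] y Ey|F oF].
  have [V [/convex_setP cV Vy VE oV]] := oE _ Ey.
  exists (val @^-1` V); split => //.
  - by apply/convex_setP => u v l Vu Vv; exact: cV.
  - by move=> z /VE.
  - move=> _ [A CA <-]; have [U oU UA] := oV A CA.
    exists (val @^-1` U); first by rewrite submod_openE; exists U.
    exact: (congr1 (preimage (val : submod_type Y -> X)) UA).
(* This is [F] together with the complement of [Y]: outside [Y] no [y] has value [x], so the
   condition is vacuous. *)
exists [set x | forall y : submod_type Y, val y = x -> F y]; last first.
  by apply/seteqP; split=> y /=; [exact|move=> Fy z /val_inj ->].
apply: near_localized_open => A CA x Ax /= Fx.
(* Off [Y], closedness gives a neighbourhood relative to [A] that avoids [Y]; on [Y], the trace of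
   an open [U] of [X] does the work. *)
have [Yx|nYx] := boolP (x \in Y); last first.
  have := localized_open_near _ oY A CA x Ax (negP nYx).
  by apply: filterS => z nYz Az y yz; case: (nYz Az); rewrite -yz; exact: valP.
pose y : submod_type Y := Sub x Yx.
have yE : val y = x by exact: SubK.
have [V [_ Vy VF /(_ (val @^-1` A))]] := oF y (Fx y yE).
case; first by exists A.
move=> _ /[1!submod_openE] -[U oU <-] UA.
have [Uy _] : (val @^-1` U `&` val @^-1` A) y.
  by rewrite UA; split => //; rewrite /preimage /= yE.
have : nbhs x U by apply: open_nbhs_nbhs; split => //; rewrite -yE.
apply: filterS => z Uz Az w wz; apply: VF.
suff [] : (V `&` val @^-1` A) w by [].
by rewrite -UA /= wz.
Qed.

End localization.

Theorem theorem4p4 (R : realType) (X : tvsType R) (C : set (set X))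
    (hausX : hausdorff_space X)
    (locC : localizing_family C)
    (ndC : nondecreasing_countable C)
    (compactC : forall A : set X, C A -> compact A)
    (seqC : forall A : set X, C A -> sequential_space (set_type A)) :
  sequential_space (localized C) /\
  (forall Y : submodClosed X,
     (@closed (localized C) [set` Y] ->
       trace Y (localized_open C) = localized_open (trace Y C)) /\
     (@closed X [set` Y] ->
       trace Y (localized_open C) = localized_open (trace Y C))).
Proof.
split; first exact: localized_sequential.
move=> Y; split=> [|/closed_openC oY]; first exact: trace_localized_open.
apply: trace_localized_open => //.
rewrite -[[set` Y]]setCK; apply: open_closedC; exact: localized_open_finer.
Qed.
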